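(* Let $(x^k)_{k\in\mathbb{N}}$ be an infinite sequence generated by GInexPM with Armijo search (as described in the context). Assume that $f^*>-\infty$, that $\nabla f$ is Lipschitz continuous on $C$ with constant $L>0$, that $(x^k)_{k\in\mathbb{N}}$ converges to a point $x^*$, and that $f$ is convex on $C$. Let $$\tau_{\min}:=\min\left\{\frac{2\tau(1-\sigma)(1-\bar\gamma)}{\alpha_{\max}L},\,1\right\},\qquad \xi:=\frac{2\alpha_{\max}}{\sigma}.$$ Then, for every integer $N\ge 1$, $$\min\{f(x^k)-f^*:\ k=0,1,\dots,N-1\}\le\frac{\|x^0-x^*\|^2+\xi\,[f(x^0)-f^*]}{2\,\alpha_{\min}\tau_{\min}}\ \frac1N.$$
   Context: Setting. $C\subset\mathbb{R}^n$ is a nonempty closed convex set, $f:\mathbb{R}^n\to\mathbb{R}$ is continuously differentiable, $f^*:=\inf_{x\in C}f(x)$; $\langle\cdot,\cdot\rangle$ and $\|\cdot\|$ are the Euclidean inner product and norm; $\mathbb{N}=\{0,1,2,\dots\}$. Lipschitz gradient on $C$: $\|\nabla f(x)-\nabla f(y)\|\le L\|x-y\|$ for all $x,y\in C$. Convexity on $C$: $f(y)-f(x)-\langle\nabla f(x),y-x\rangle\ge 0$ for all $x,y\in C$. Inexact projection. For each $\gamma_3\ge 0$, $\varphi_{\gamma_3}:\mathbb{R}^n\times\mathbb{R}^n\to[0,\infty)$ is a function with $\varphi_{\gamma_3}(u,w)\le\gamma_3\|w-u\|^2$ for all $u,w$, and the map $(\gamma_3,u,w)\mapsto\varphi_{\gamma_3}(u,w)$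 is continuous. For $u\in C$, $v\in\mathbb{R}^n$, $\mathcal{P}_C(\varphi_{\gamma_3},u,v):=\{w\in C:\langle v-w,y-w\rangle\le\varphi_{\gamma_3}(u,w)\ \forall y\in C\}$. GInexPM with Armijo search. Fix $\sigma,\tau\in(0,1)$, $0<\alpha_{\min}\le\alpha_{\max}$, $\bar\gamma<1/2$, and $x^0\in C$. At iteration $k$: choose reals $\alpha_k,\gamma_3^k$ with $\alpha_{\min}\le\alpha_k\le\alpha_{\max}$ and $0\le\gamma_3^k\le\bar\gamma$, set $z^k:=x^k-\alpha_k\nabla f(x^k)$ and take any $w^k\in\mathcal{P}_C(\varphi_{\gamma_3^k},x^k,z^k)$. If $w^k=x^k$, stop. Otherwise set $\tau_k:=\tau^{j_k}$ with $j_k:=\min\{j\in\mathbb{N}: f(x^k+\tau^j(w^k-x^k))\le f(x^k)+\sigma\tau^j\langle\nabla f(x^k),w^k-x^k\rangle\}$ and $x^{k+1}:=x^k+\tau_k(w^k-x^k)$. ''Infinite sequence generated'' means the algorithm never stops (a standing assumption of the paper). *)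

(* Defs.v *)
From HB Require Import structures.
From mathcomp Require Import all_boot all_order all_algebra.
From mathcomp Require Import all_classical all_reals all_analysis.

Set Implicit Arguments.
Unset Strict Implicit.
Unset Printing Implicit Defensive.

Import Order.TTheory GRing.Theory Num.Theory.
Import numFieldNormedType.Exports.

Local Open Scope classical_set_scope.
Local Open Scope ring_scope.

Definition dotp (R : realType) (n : nat) (u v : 'rV[R]_n) : R :=
  \sum_(i < n) u 0 i * v 0 i.

(* The library norm `|u| on 'rV[R]_n is the sup norm. It induces the same
   topology as the Euclidean norm, so open/closed sets, limits and
   differentiability below are the library's. *)
Definition enorm (R : realType) (n : nat) (u : 'rV[R]_n) : R :=
  Num.sqrt (dotp u u).

Definition grad (R : realType) (n : nat) (f : 'rV[R]_n -> R) (x : 'rV[R]_n) :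
    'rV[R]_n :=
  \row_(i < n) 'D_(delta_mx 0 i) f x.

Definition continuously_differentiable (R : realType) (n : nat)
    (f : 'rV[R]_n -> R) : Prop :=
  (forall x, differentiable f x) /\ continuous (grad f).

Definition grad_lipschitz_on (R : realType) (n : nat) (C : set 'rV[R]_n)
    (f : 'rV[R]_n -> R) (L : R) : Prop :=
  forall x y, C x -> C y -> enorm (grad f x - grad f y) <= L * enorm (x - y).

Definition convex_on (R : realType) (n : nat) (C : set 'rV[R]_n)
    (f : 'rV[R]_n -> R) : Prop :=
  forall x y, C x -> C y -> 0 <= f y - f x - dotp (grad f x) (y - x).

Definition optimal_value (R : realType) (n : nat) (C : set 'rV[R]_n)
    (f : 'rV[R]_n -> R) : \bar R :=
  ereal_inf [set (f x)%:E | x in C].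

(* phi g is only meaningful for g >= 0; its values for g < 0 are unconstrained,
   and joint continuity is relative to [0, +oo[ x R^n x R^n. *)
Definition error_tolerance (R : realType) (n : nat)
    (phi : R -> 'rV[R]_n -> 'rV[R]_n -> R) : Prop :=
  [/\ forall g u w, 0 <= g -> 0 <= phi g u w,
      forall g u w, 0 <= g -> phi g u w <= g * enorm (w - u) ^+ 2
    & {within [set p : R * 'rV[R]_n * 'rV[R]_n | 0 <= p.1.1],
        continuous (fun p : R * 'rV[R]_n * 'rV[R]_n => phi p.1.1 p.1.2 p.2)}].

Definition inexact_proj (R : realType) (n : nat) (C : set 'rV[R]_n)
    (phi : 'rV[R]_n -> 'rV[R]_n -> R) (u v : 'rV[R]_n) : set 'rV[R]_n :=
  [set w | C w /\ forall y, C y -> dotp (v - w) (y - w) <= phi u w].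

Definition armijo (R : realType) (n : nat) (f : 'rV[R]_n -> R) (sigma tau : R)
    (x w : 'rV[R]_n) (j : nat) : Prop :=
  f (x + tau ^+ j *: (w - x))
    <= f x + sigma * tau ^+ j * dotp (grad f x) (w - x).

(* x is an infinite sequence of iterates: the stopping test w k = x k never
   succeeds. *)
Definition GInexPM_armijo (R : realType) (n : nat) (C : set 'rV[R]_n)
    (f : 'rV[R]_n -> R) (phi : R -> 'rV[R]_n -> 'rV[R]_n -> R)
    (sigma tau alphamin alphamax gammabar : R) (x : nat -> 'rV[R]_n) : Prop :=
  C (x 0%N) /\
  exists (alpha gamma3 : nat -> R) (w : nat -> 'rV[R]_n) (j : nat -> nat),
    forall k,
    [/\ alphamin <= alpha k <= alphamax,
        0 <= gamma3 k <= gammabar,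
        inexact_proj C (phi (gamma3 k)) (x k)
          (x k - alpha k *: grad f (x k)) (w k),
        w k <> x k
      & [/\ armijo f sigma tau (x k) (w k) (j k),
            forall i, (i < j k)%N -> ~ armijo f sigma tau (x k) (w k) i
          & x k.+1 = x k + tau ^+ j k *: (w k - x k)]].

(* Main.v *)
Require Import Defs.
From mathcomp Require Import all_boot all_order all_algebra.
From mathcomp Require Import all_classical all_reals all_analysis.
From mathcomp Require Import ring lra.

(** The proof is a Lyapunov argument.  Write [d = w - x] for the search
    direction of an iteration.  For every [y] in [C], testing the inexact
    projection against [y], then using convexity of [f] to compare [y] with
    [x] and the Armijo inequality to bound [- t * dotp (grad f x) d] by the
    decrease of [f], shows that
    [[
      2 t alpha (f x - f y)
        <= |x - y|^2 - |x+ - y|^2 + xi (f x - f x+),      x+ = x + t d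
    ]]
    ([armijo_step_dist]); the quadratic terms in [d] have the right sign
    because [gammabar <= 1/2].  The factor [t alpha] is at least
    [taumin * alphamin]: a step shorter than 1 means that the previous trial
    step failed the Armijo test, which by the descent lemma is impossible for
    short steps ([armijo_step_ge]).  Hence, as long as [f y <= f x], the
    energy [|x_k - y|^2 + xi f(x_k)] drops by at least a fixed multiple of
    [f x - f y] at each iteration ([iterate_rate]), and telescoping gives a
    rate [1/N] ([telescope_rate]).

    This is used twice.  With an arbitrary [y] in [C] below all the iterates,
    the rate forces [f xstar <= f y]; as [f] decreases along the iterates, the
    other [y] are immediate.  So [xstar] is a minimizer ([limit_minimizes]),
    without going through stationarity.  With [y = xstar], the rate is the
    claimed bound.

    The descent lemma is derived from convexity and the Lipschitz bound on
    [grad f] alone ([convex_descent]): the gradient inequality is summed over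
    a subdivision of the segment, which replaces the integration of [grad f]
    along it. *)

Import Order.TTheory GRing.Theory Num.Theory.
Import numFieldNormedType.Exports.

Local Open Scope classical_set_scope.
Local Open Scope ring_scope.

(** * Euclidean inner product *)

Section dotp_theory.
Context {R : realType} {n : nat}.
Implicit Types (u v w : 'rV[R]_n) (a K : R).

Lemma dotpC u v : dotp u v = dotp v u.
Proof. by apply: eq_bigr => i _; rewrite mulrC. Qed.

Lemma dotpDr u v w : dotp u (v + w) = dotp u v + dotp u w.
Proof.
by rewrite -big_split; apply: eq_bigr => i _; rewrite !mxE mulrDr.
Qed.

Lemma dotpZr a u v : dotp u (a *: v) = a * dotp u v.
Proof. by rewrite mulr_sumr; apply: eq_bigr => i _; rewrite !mxE mulrCA. Qed.

Lemma dotpNr u v : dotp u (- v) = - dotp u v.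
Proof. by rewrite -scaleN1r dotpZr mulN1r. Qed.

Lemma dotpDl u v w : dotp (u + v) w = dotp u w + dotp v w.
Proof. by rewrite !(dotpC _ w) dotpDr. Qed.

Lemma dotpZl a u v : dotp (a *: u) v = a * dotp u v.
Proof. by rewrite !(dotpC _ v) dotpZr. Qed.

Lemma dotpNl u v : dotp (- u) v = - dotp u v.
Proof. by rewrite !(dotpC _ v) dotpNr. Qed.

Definition dotpE := (dotpDl, dotpDr, dotpNl, dotpNr, dotpZl, dotpZr).

Lemma dotp_ge0 u : 0 <= dotp u u.
Proof. by apply: sumr_ge0 => i _; rewrite -expr2 sqr_ge0. Qed.

Lemma dotp_gt0 u : u != 0 -> 0 < dotp u u.
Proof.
move=> u0; rewrite lt_def dotp_ge0 andbT; apply: contraNneq u0 => uu0.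
apply/eqP/rowP => i; rewrite mxE; apply/eqP; rewrite -sqrf_eq0 expr2.
have /eqP := uu0; rewrite psumr_eq0 => [/allP/(_ i)|j _]; last first.
  by rewrite -expr2 sqr_ge0.
by rewrite mem_index_enum => /(_ isT).
Qed.

Lemma sqr_enorm u : enorm u ^+ 2 = dotp u u.
Proof. by rewrite sqr_sqrtr // dotp_ge0. Qed.

(** A substitute for the Cauchy-Schwarz inequality: it suffices to expand
    the square of [u - K *: v]. *)
Lemma dotp_le_of_enorm_le K u v : 0 < K ->
  enorm u <= K * enorm v -> dotp u v <= K * dotp v v.
Proof.
move=> K0 uv.
have : enorm u ^+ 2 <= (K * enorm v) ^+ 2.
  by rewrite lerXn2r ?nnegrE ?mulr_ge0 ?sqrtr_ge0 // ltW.
rewrite exprMn !sqr_enorm => uuvv.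
have := dotp_ge0 (u - K *: v); rewrite !dotpE (dotpC v u) => sq.
rewrite -(ler_pM2l K0); nra.
Qed.

End dotp_theory.

(** * The descent lemma *)

(** Used both to refine subdivisions in the descent lemma and to turn a rate
    [1/N] into an inequality at the limit. *)
Lemma le_of_le_harmonic (R : realType) (a b c : R) :
  (forall m : nat, a <= b + c * m.+1%:R^-1) -> a <= b.
Proof.
move=> h.
have lim : (fun m => b + c * harmonic m) @ \oo --> b + c * 0.
  by apply: cvgD; [exact: cvg_cst|apply: cvgMr; exact: cvg_harmonic].
rewrite -[b]addr0 -[0](mulr0 c).
by apply: (cvgr_to_ge lim); apply: nearW => m; exact: h.
Qed.

Section descent.
Context {R : realType} {n : nat} {C : set 'rV[R]_n} {f : 'rV[R]_n -> R}.

Lemma convex_set_segment (x y : 'rV[R]_n) (t : R) : convex_set C ->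
  C x -> C y -> 0 <= t <= 1 -> C (x + t *: (y - x)).
Proof.
move=> Cc Cx Cy t01.
have t_itv : Itv.spec (@Itv.num_sem R) (Itv.Real `[0%Z, 1%Z]) t.
  by rewrite /= /Itv.num_sem /= in_itv /= t01 ger0_real //; case/andP: t01.
have := Cc y x (Itv.mk t_itv); rewrite !inE => /(_ Cy Cx).
have -> // : conv (Itv.mk t_itv) (y : convex_lmodType _) x = x + t *: (y - x).
rewrite [LHS](_ : _ = t *: y + (1 - t) *: x) //.
by apply/rowP => i; rewrite !mxE; ring.
Qed.

(** Bounding [f y - f x] by the gradient at [y] alone would lose a factor 2
    in the quadratic term, hence in [taumin].  Cutting the segment into [m.+1]
    pieces and using the gradient at the end of each piece loses only a factor
    [1 + 1 / m.+1], since the errors add up to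
    [1 + 2 + .. + m.+1 = (m.+1) * (m.+2) / 2] times [L |d|^2 / m.+1 ^ 2]. *)
Lemma convex_descent (L : R) (x y : 'rV[R]_n) : 0 < L -> convex_set C ->
  grad_lipschitz_on C f L -> convex_on C f -> C x -> C y ->
  f y <= f x + dotp (grad f x) (y - x) + L / 2 * dotp (y - x) (y - x).
Proof.
move=> L0 Cc lip cvx Cx Cy; set d := y - x.
apply: (@le_of_le_harmonic _ _ _ (L / 2 * dotp d d)) => m.
set h : R := m.+1%:R^-1.
have h0 : 0 < h by rewrite invr_gt0.
have hm : m.+1%:R * h = 1 by rewrite divff ?pnatr_eq0.
have Cp k : (k <= m.+1)%N -> C (x + (k%:R * h) *: d).
  move=> km; apply: convex_set_segment => //.
  by rewrite mulr_ge0 ?(ltW h0) //= -[leRHS]hm ler_pM2r // ler_nat.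
have xd : x + d = y by rewrite addrC subrK.
clearbody d.
have partial (i : nat) : (i <= m.+1)%N ->
  f (x + (i%:R * h) *: d) <= f x + i%:R * h * dotp (grad f x) d
    + L / 2 * dotp d d * (i%:R * (i%:R + 1) * h ^+ 2).
  elim: i => [_|i IH im]; first by rewrite !mul0r scale0r !addr0 mulr0 addr0.
  (* convexity is taken at the far end [q] of the piece, and the gradient at
     [q] is compared with the one at [x] *)
  have {IH} := IH (ltnW im).
  have := cvx _ _ (Cp _ im) (Cp _ (ltnW im)).
  have := lip _ _ (Cp _ im) Cx.
  set p := x + (i%:R * h) *: d; set q := x + (i.+1%:R * h) *: d.
  have -> : p - q = - (h *: d).
    by apply/rowP => k; rewrite !mxE -natr1; ring.
  have -> : q - x = (i.+1%:R * h) *: d by rewrite addrC addKr.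
  move=> /(dotp_le_of_enorm_le _ _ _ L0); rewrite !dotpE -natr1.
  have i0 : 0 <= i%:R :> R by [].
  move: (i%:R : R) i0 (dotp (grad f q) d) (dotp (grad f x) d) (dotp d d).
  move=> I I0 G g D.
  have s0 : 0 < (I + 1) * h by rewrite mulr_gt0 // ltr_wpDl.
  have -> : L * ((I + 1) * h * ((I + 1) * h * D)) =
            (I + 1) * h * (L * ((I + 1) * h * D)) by ring.
  rewrite -mulrBr ler_pM2l // => Gg cv IH.
  have {}Gg := ler_wpM2l (ltW h0) Gg.
  move: (f q) (f p) (f x) cv IH Gg => fq fp fx; nra.
have := partial m.+1 (leqnn _).
rewrite !hm scale1r mul1r.
have -> : m.+1%:R * (m.+1%:R + 1) * h ^+ 2 = 1 + h.
  have -> : m.+1%:R * (m.+1%:R + 1) * h ^+ 2 =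
    (m.+1%:R * h) ^+ 2 + (m.+1%:R * h) * h by ring.
  by rewrite hm expr1n mul1r.
by rewrite xd mulrDr mulr1 addrA.
Qed.

End descent.

(** * A single iteration *)

Section iteration.
Context {R : realType} {n : nat} {C : set 'rV[R]_n} {f : 'rV[R]_n -> R}.
Context {phi : 'rV[R]_n -> 'rV[R]_n -> R} {x w : 'rV[R]_n}.
Context {alpha alphamax gamma sigma tau : R}.
Hypothesis alpha_gt0 : 0 < alpha.
Hypothesis alpha_le : alpha <= alphamax.
Hypothesis gamma_le : gamma <= 2^-1.
Hypothesis sigma01 : 0 < sigma < 1.
Hypothesis phi_le : phi x w <= gamma * enorm (w - x) ^+ 2.
Hypothesis w_proj : inexact_proj C phi x (x - alpha *: grad f x) w.
Hypothesis Cx : C x.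

(** The only form in which the projection is used.  Its left-hand side
    collects [alpha * grad f x] and [w - x], so that the choices [y = x] and
    [y] arbitrary give the descent property of [w - x] and the distance
    estimate respectively. *)
Lemma inexact_proj_le y : C y ->
  alpha * dotp (grad f x) (w - y) + dotp (w - x) (w - y)
    <= gamma * dotp (w - x) (w - x).
Proof.
move=> Cy; rewrite -[in leRHS]sqr_enorm; apply: le_trans phi_le.
apply: le_trans (w_proj.2 y Cy).
by rewrite !dotpE; lra.
Qed.

Lemma inexact_proj_descent :
  (1 - gamma) * dotp (w - x) (w - x) <= - (alpha * dotp (grad f x) (w - x)).
Proof. by have := inexact_proj_le _ Cx; lra. Qed.

Lemma grad_dir_le0 : dotp (grad f x) (w - x) <= 0.
Proof.
rewrite -oppr_ge0 -(pmulr_rge0 _ alpha_gt0) mulrN.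
apply: le_trans inexact_proj_descent; rewrite mulr_ge0 ?dotp_ge0 //.
by have := gamma_le; lra.
Qed.

(** If [j > 0], the trial step [t = tau ^+ j.-1] was rejected; comparing this
    with the descent lemma bounds [(1 - sigma) * - dotp (grad f x) (w - x)] by
    [L / 2 * t * |w - x|^2], while the projection bounds the same scalar
    product from below by a multiple of [|w - x|^2], so that [|w - x|^2 > 0]
    cancels. *)
Lemma armijo_step_ge L j : 0 < L -> convex_set C -> grad_lipschitz_on C f L ->
  convex_on C f -> 0 < tau < 1 -> w <> x ->
  (forall i, (i < j)%N -> ~ armijo f sigma tau x w i) ->
  Num.min (2 * tau * (1 - sigma) * (1 - gamma) / (alphamax * L)) 1 <= tau ^+ j.
Proof.
move=> L0 Cc lip cvx /andP[tau0 tau1] wx jmin.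
case: j jmin => [_|j jmin]; first by rewrite ge_min lexx orbT.
have /negP := jmin j (leqnn _); rewrite /armijo -ltNge.
rewrite ge_min; set t := tau ^+ j => fail; apply/orP; left.
have t0 : 0 < t by rewrite exprn_gt0.
have t1 : t <= 1 by rewrite exprn_ile1 ?ltW.
have dd0 : 0 < dotp (w - x) (w - x).
  by rewrite dotp_gt0 ?subr_eq0; last exact/eqP.
have Ct : C (x + t *: (w - x)).
  by apply: convex_set_segment => //; [exact: w_proj.1|rewrite ltW].
have := convex_descent L x (x + t *: (w - x)) L0 Cc lip cvx Cx Ct.
have -> : x + t *: (w - x) - x = t *: (w - x) by rewrite addrC addKr.
move: fail inexact_proj_descent grad_dir_le0 dd0; rewrite (dotpZr t (grad f x)).
rewrite dotpZl dotpZr.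
set D := dotp (w - x) (w - x); set G := dotp (grad f x) (w - x).
move: (f _) (f x) => ft fx fail desc G0 D0 dl.
have amax0 : 0 < alphamax by apply: lt_le_trans alpha_le.
rewrite ler_pdivrMr ?mulr_gt0 // exprS -/t -!mulrA mulrCA ler_pM2l //.
have h1 : (1 - sigma) * - G <= L / 2 * t * D.
  by rewrite -(ler_pM2l t0); lra.
have h2 : (1 - gamma) * D <= alphamax * - G.
  by apply: le_trans desc _; rewrite -mulrN ler_wpM2r // oppr_ge0.
rewrite -(ler_pM2r D0).
have := ler_wpM2l (ltW amax0) h1.
have s1 : 0 <= 1 - sigma by case/andP: sigma01 => _ /ltW; rewrite subr_ge0.
have := ler_wpM2l s1 h2.
lra.
Qed.

(** Expanding [|x + t d - y|^2] leaves the term [t^2 |d|^2 - 2 t |d|^2], and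
    the projection contributes [2 t gamma |d|^2]; the total is at most
    [t (2 gamma - 1) |d|^2 <= 0] because [t <= 1] and [gamma <= 1/2]. *)
Lemma armijo_step_dist (t : R) y : 0 <= t <= 1 -> convex_on C f ->
  f (x + t *: (w - x)) <= f x + sigma * t * dotp (grad f x) (w - x) ->
  C y ->
  2 * (t * alpha) * (f x - f y)
    <= enorm (x - y) ^+ 2 - enorm (x + t *: (w - x) - y) ^+ 2
       + 2 * alphamax / sigma * (f x - f (x + t *: (w - x))).
Proof.
move=> /andP[t0 t1] cvx arm Cy.
have [s0 s1] := andP sigma01.
have amax0 : 0 < alphamax by apply: lt_le_trans alpha_le.
have := inexact_proj_le _ Cy; have := cvx _ _ Cx Cy.
have := grad_dir_le0; have := dotp_ge0 (w - x).
rewrite !sqr_enorm.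
have -> : w - y = (w - x) - (y - x) by rewrite opprB addrA subrK.
have -> : x + t *: (w - x) - y = t *: (w - x) - (y - x).
  by rewrite opprB addrCA addrA.
rewrite -[x - y]opprB; move: arm.
move: (f (x + t *: (w - x))) => ft.
move: (w - x) (y - x) => d e; rewrite !dotpE (dotpC e d).
set G := dotp (grad f x) d; set E := dotp (grad f x) e.
move: (dotp d d) (dotp d e) (dotp e e) => D P Q arm D0 G0 cv pr.
(* Armijo's inequality divided by [sigma]; replacing [alpha] by [alphamax]
   uses the sign of the directional derivative *)
have tG : - (2 * t * alpha * G) <= 2 * alphamax / sigma * (f x - ft).
  have e1 : - (2 * t * alpha * G) <= 2 * alphamax * (t * - G).
    have : 0 <= t * - G by rewrite mulr_ge0 ?oppr_ge0.
    by move=> /(ler_wpM2r)/(_ _ _ alpha_le); lra.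
  apply: le_trans e1 _; rewrite -!mulrA ler_pM2l // ler_pM2l //.
  by rewrite ler_pdivlMl //; lra.
have ta0 : 0 <= t * alpha by rewrite mulr_ge0 // ltW.
have := ler_wpM2l ta0 cv; have := ler_wpM2l t0 pr.
have tt : t * t * D <= t * D by rewrite ler_wpM2r // ler_piMr.
have tg : t * gamma * D <= t * 2^-1 * D by rewrite ler_wpM2r // ler_wpM2l.
lra.
Qed.

End iteration.

(** * The whole sequence *)

Lemma telescope_rate (R : realType) (c m : R) (F E : nat -> R) (N : nat) :
  0 <= c -> (forall k, (k < N)%N -> m <= F k) ->
  (forall k, c * F k <= E k - E k.+1) -> N%:R * (c * m) <= E 0%N - E N.
Proof.
move=> c0 mF FE; elim: N mF => [|N IH] mF; first by rewrite mul0r subrr.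
have := IH (fun k kN => mF k (ltnW kN)); have := FE N.
have := ler_wpM2l c0 (mF N (leqnn _)).
by rewrite -natr1; lra.
Qed.

Section sequence.
Context {R : realType} {n : nat} {C : set 'rV[R]_n} {f : 'rV[R]_n -> R}.
Context {phi : R -> 'rV[R]_n -> 'rV[R]_n -> R}.
Context {sigma tau alphamin alphamax gammabar L : R} {x : nat -> 'rV[R]_n}.
Hypothesis C_convex : convex_set C.
Hypothesis phi_tol : error_tolerance phi.
Hypothesis sigma01 : 0 < sigma < 1.
Hypothesis tau01 : 0 < tau < 1.
Hypothesis alphamin_gt0 : 0 < alphamin.
Hypothesis alphamin_le : alphamin <= alphamax.
Hypothesis gammabar_lt : gammabar < 2^-1.
Hypothesis x_gen :
  GInexPM_armijo C f phi sigma tau alphamin alphamax gammabar x.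
Hypothesis L_gt0 : 0 < L.
Hypothesis grad_lip : grad_lipschitz_on C f L.
Hypothesis f_convex : convex_on C f.

Let taumin :=
  Num.min (2 * tau * (1 - sigma) * (1 - gammabar) / (alphamax * L)) 1.
Let xi := 2 * alphamax / sigma.
Let rate := 2 * alphamin * taumin.

Lemma rate_gt0 : 0 < rate.
Proof.
have [s0 s1] := andP sigma01; have [t0 t1] := andP tau01.
have a0 : 0 < alphamax by apply: lt_le_trans alphamin_le.
rewrite /rate /taumin mulr_gt0 ?mulr_gt0 // lt_min ltr01 andbT.
rewrite divr_gt0 ?mulr_gt0 ?subr_gt0 //.
by apply: lt_trans gammabar_lt _; lra.
Qed.

Lemma iterate_mem k : C (x k).
Proof.
have [t0 t1] := andP tau01; have [Cx0 [a [g [w [j step]]]]] := x_gen.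
elim: k => [//|k IH]; have [_ _ [Cw _] _ [_ _ ->]] := step k.
apply: convex_set_segment => //.
by rewrite exprn_ge0 ?exprn_ile1 // ltW.
Qed.

Lemma iterate_decr k : f (x k.+1) <= f (x k).
Proof.
have [s0 s1] := andP sigma01; have [t0 t1] := andP tau01.
have [_ [a [g [w [j step]]]]] := x_gen.
have [/andP[a1 a2] /andP[g0 g1] pr wx [arm _ ->]] := step k.
apply: le_trans arm _; rewrite gerDl mulr_ge0_le0 //.
  by rewrite mulr_ge0 ?exprn_ge0 ?ltW.
have ak : 0 < a k by apply: lt_le_trans a1.
have gk : g k <= 2^-1 by apply: le_trans g1 (ltW gammabar_lt).
have pg : phi (g k) (x k) (w k) <= g k * enorm (w k - x k) ^+ 2.
  by case: phi_tol => _ + _; apply.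
exact: (grad_dir_le0 ak gk pg pr (iterate_mem k)).
Qed.

(** The assumption [f y <= f (x k)] is what allows the step [tau ^+ j k] and
    [alpha k] to be replaced by their lower bounds. *)
Lemma iterate_rate y k : C y -> f y <= f (x k) ->
  rate * (f (x k) - f y)
    <= (enorm (x k - y) ^+ 2 + xi * f (x k))
       - (enorm (x k.+1 - y) ^+ 2 + xi * f (x k.+1)).
Proof.
move=> Cy fyx.
have [t0 t1] := andP tau01.
have [_ [a [g [w [j step]]]]] := x_gen.
have [/andP[a1 a2] /andP[g0 g1] pr wx [arm jmin xS]] := step k.
have ak : 0 < a k by apply: lt_le_trans a1.
have pg : phi (g k) (x k) (w k) <= gammabar * enorm (w k - x k) ^+ 2.
  case: phi_tol => _ + _ => /(_ (g k) (x k) (w k) g0) /le_trans; apply.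
  by rewrite ler_wpM2r // exprn_even_ge0.
have t01 : 0 <= tau ^+ j k <= 1 by rewrite exprn_ge0 ?exprn_ile1 // ltW.
have := armijo_step_dist ak a2 (ltW gammabar_lt) sigma01 pg pr (iterate_mem k)
  _ _ t01 f_convex arm Cy.
rewrite -xS -/xi.
have tj : taumin <= tau ^+ j k.
  exact: (armijo_step_ge ak a2 (ltW gammabar_lt) sigma01 pg pr (iterate_mem k)
    _ _ L_gt0 C_convex grad_lip f_convex tau01 wx jmin).
have : rate * (f (x k) - f y) <= 2 * (tau ^+ j k * a k) * (f (x k) - f y).
  rewrite ler_wpM2r ?subr_ge0 // /rate -mulrA ler_wpM2l // mulrC.
  apply: le_trans (ler_wpM2r (ltW alphamin_gt0) tj) _.
  by rewrite ler_wpM2l //; case/andP: t01.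
lra.
Qed.

(** Since the values [f (x k)] decrease to [f xstar], a point [y] that is not
    below all the iterates is above the limit.  Otherwise the energy estimate
    holds at every iteration, with [f (x k) - f y >= f xstar - f y], and its
    sum bounds [f xstar - f y] by a constant over [N]. *)
Lemma limit_minimizes xstar y : {for xstar, continuous f} ->
  x @ \oo --> xstar -> C y -> f xstar <= f y.
Proof.
move=> fc xs Cy.
have fx : (fun k => f (x k)) @ \oo --> f xstar by exact: cvg_comp xs fc.
have decr : nonincreasing_seq (fun k => f (x k)).
  by apply/nonincreasing_seqP => k; exact: iterate_decr.
have fs k : f xstar <= f (x k).
  rewrite -(cvg_lim _ fx) //.
  by apply: nonincreasing_cvgn_ge => //; exact: cvgP fx.
have [[k fk]|below] := pselect (exists k, f (x k) < f y).
  exact: le_trans (fs k) (ltW fk).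
have {}below k : f y <= f (x k).
  by rewrite leNgt; apply/negP => h; apply: below; exists k.
set E := fun k => enorm (x k - y) ^+ 2 + xi * f (x k).
have xi0 : 0 <= xi.
  have [s0 s1] := andP sigma01.
  by rewrite /xi divr_ge0 ?mulr_ge0 ?ltW // (lt_le_trans alphamin_gt0).
apply: (@le_of_le_harmonic _ _ _ ((E 0%N - xi * f y) / rate)) => m.
have := @telescope_rate R rate (f xstar - f y)
  (fun k => f (x k) - f y) E m.+1 (ltW rate_gt0)
  (fun k _ => lerB (fs k) (lexx _)) (fun k => iterate_rate _ _ Cy (below k)).
move=> sum; rewrite -lerBlDl ler_pdivlMr // ler_pdivlMr ?rate_gt0 //.
move: sum; have : xi * f y <= E m.+1.
  by rewrite -[leLHS]add0r lerD ?exprn_even_ge0 // ler_wpM2l.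
lra.
Qed.

End sequence.

Theorem theorem26 (R : realType) (n : nat) (C : set 'rV[R]_n)
    (f : 'rV[R]_n -> R) (phi : R -> 'rV[R]_n -> 'rV[R]_n -> R)
    (sigma tau alphamin alphamax gammabar L : R)
    (x : nat -> 'rV[R]_n) (xstar : 'rV[R]_n)
    (C_nonempty : C !=set0) (C_closed : closed C) (C_convex : convex_set C)
    (f_C1 : continuously_differentiable f)
    (phi_tol : error_tolerance phi)
    (sigma01 : 0 < sigma < 1) (tau01 : 0 < tau < 1)
    (alphamin_gt0 : 0 < alphamin) (alphamin_le : alphamin <= alphamax)
    (gammabar_lt : gammabar < 2^-1)
    (x_gen : GInexPM_armijo C f phi sigma tau alphamin alphamax gammabar x)
    (fstar_gtNy : (-oo < optimal_value C f)%E)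
    (L_gt0 : 0 < L) (grad_lip : grad_lipschitz_on C f L)
    (x_cvg : x @ \oo --> xstar)
    (f_convex : convex_on C f) :
  let fstar := fine (optimal_value C f) in
  let taumin :=
    Num.min (2 * tau * (1 - sigma) * (1 - gammabar) / (alphamax * L)) 1 in
  let xi := 2 * alphamax / sigma in
  forall N : nat, (1 <= N)%N ->
    \big[Num.min/f (x 0%N) - fstar]_(k < N) (f (x k) - fstar)
      <= (enorm (x 0%N - xstar) ^+ 2 + xi * (f (x 0%N) - fstar))
           / (2 * alphamin * taumin) * N%:R^-1.
Proof.
move=> fstar taumin xi N N1.
have memC := iterate_mem C_convex tau01 x_gen.
have Cs : C xstar.
  by apply: (closed_cvg _ C_closed _ _ x_cvg); apply: nearW => k; exact: memC.
have fc : {for xstar, continuous f}.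
  exact/differentiable_continuous/f_C1.1.
have fmin y : C y -> f xstar <= f y.
  exact: (limit_minimizes C_convex phi_tol sigma01 tau01 alphamin_gt0
    alphamin_le gammabar_lt x_gen L_gt0 grad_lip f_convex _ _ fc x_cvg).
have -> : fstar = f xstar.
  rewrite /fstar (_ : optimal_value C f = (f xstar)%:E) //.
  apply/eqP; rewrite eq_le; apply/andP; split.
    by apply: ereal_inf_lbound; exists xstar.
  by apply: le_ereal_inf_tmp => _ [y Cy <-]; rewrite lee_fin fmin.
have r0 : 0 < 2 * alphamin * taumin.
  exact: (rate_gt0 sigma01 tau01 alphamin_gt0 alphamin_le gammabar_lt L_gt0).
rewrite ler_pdivlMr ?ltr0n // ler_pdivlMr //.
have xi0 : 0 <= xi.
  have [s0 s1] := andP sigma01.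
  by rewrite /xi divr_ge0 ?mulr_ge0 ?ltW // (lt_le_trans alphamin_gt0).
set M := \big[_/_]_(_ < _) _.
have MF k : (k < N)%N -> M <= f (x k) - f xstar.
  by move=> kN; exact: (bigmin_le _ (Ordinal kN)).
pose E k := enorm (x k - xstar) ^+ 2 + xi * f (x k).
have := @telescope_rate R _ M (fun k => f (x k) - f xstar) E N (ltW r0) MF
  (fun k => iterate_rate C_convex phi_tol sigma01 tau01 alphamin_gt0
     gammabar_lt x_gen L_gt0 grad_lip f_convex _ _ Cs (fmin _ (memC k))).
have : xi * f xstar <= E N.
  by rewrite -[leLHS]add0r lerD ?exprn_even_ge0 // ler_wpM2l // fmin.
rewrite /E; lra.
Qed.
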